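(* Let $\mathcal F=\emptyset$, $\kappa=5$, and let $\gamma(H)=0$ for every graph $H$ of order 5 except $\gamma(K_{3,2})=1$. Let $B=K_2$. Then the corresponding problem (the inducibility of $K_{3,2}$) is perfectly $B$-stable; moreover $\lim_{n\to\infty}\lambda(n,\mathcal G)=5/8$ and the unique maximiser of $\lambda(B(\mathbf a))$ over $\mathbf a\in\mathbb S_2$ is $(1/2,1/2)$.
   Context: All graphs are finite and simple; ''subgraph'' means induced subgraph. $P(F,G)$ is the number of $v(F)$-subsets of $V(G)$ inducing a copy of $F$, $p(F,G)=P(F,G)/\binom{v(G)}{v(F)}$. Admissible graphs are those containing no member of $\mathcal F$ as induced subgraph (here all graphs); $\mathcal G$ is the class of admissible graphs. $\Lambda(G)=\sum_H\gamma(H)P(H,G)$ over isomorphism classes $H$ of order-$\kappa$ graphs, $\lambda(G)=\Lambda(G)/\binom{v(G)}\kappa$, $\lambda(n,\mathcal G)=\max\{\lambda(G):G\in\mathcal G,v(G)=n\}$. For a graph $B$ on $[m]$ and disjoint sets $V_1,\dots,V_m$, the blow-up $B(V_1,\dots,V_m)$ has vertex set $\bigcup V_i$, with $u\in V_i,w\in V_j$ adjacent iff $ij\in E(B)$; $B()$ is the family of all blow-ups. $\mathbb S_m$ is the simplex of probability vectors in $\mathbb R^m$; $\lambda(B(\mathbf a))=\lim_{n}\lambda(B(V_{1,n},\dots,V_{m,n}))$ with $|V_{i,n}|=a_in+O(1)$. $\delta_{\mathrm{edit}}(G,B())$ is the minimal number of adjacency changes turning $G$ (order $n$) into a blow-up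 of $B$, divided by $\binom n2$. Perfectly $B$-stable: there is $C>0$ with $\delta_{\mathrm{edit}}(G,B())\le C(\lambda(n,\mathcal G)-\lambda(G))$ for all admissible $G$ of order $n\ge C$. *)

(* Defs.v *)
From HB Require Import structures.
From mathcomp Require Import all_boot all_order all_algebra.
From mathcomp Require Import all_classical all_reals all_analysis.

Set Implicit Arguments.
Unset Strict Implicit.
Unset Printing Implicit Defensive.

Import Order.TTheory GRing.Theory Num.Theory.
Import numFieldNormedType.Exports.

Local Open Scope classical_set_scope.
Local Open Scope ring_scope.

Definition simple_adj (T : finType) (e : {ffun T * T -> bool}) : bool :=
  [forall x, ~~ e (x, x)] && [forall x, forall y, e (x, y) == e (y, x)].

Record sgraph (T : finType) := SGraph {
  adjf : {ffun T * T -> bool};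
  adjf_simple : simple_adj adjf }.

HB.instance Definition _ (T : finType) := [isSub for @adjf T].
HB.instance Definition _ (T : finType) := [Finite of sgraph T by <:].

Definition adj (T : finType) (G : sgraph T) : rel T := fun x y => adjf G (x, y).

Lemma simple_adj_rel (T : finType) (r : rel T) :
  irreflexive r -> symmetric r -> simple_adj [ffun p : T * T => r p.1 p.2].
Proof.
move=> irr sym; apply/andP; split.
  by apply/forallP => x; rewrite ffunE /= irr.
by apply/forallP => x; apply/forallP => y; rewrite !ffunE /= sym.
Qed.

Definition mk_sgraph (T : finType) (r : rel T)
    (irr : irreflexive r) (sym : symmetric r) : sgraph T :=
  SGraph (simple_adj_rel irr sym).

Lemma adj_mk (T : finType) (r : rel T) irr sym x y :
  adj (@mk_sgraph T r irr sym) x y = r x y.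
Proof. by rewrite /adj /= ffunE. Qed.

Lemma adj_irr (T : finType) (G : sgraph T) : irreflexive (adj G).
Proof. by move=> x; case/andP: (adjf_simple G) => /forallP/(_ x)/negbTE. Qed.

Lemma adj_sym (T : finType) (G : sgraph T) : symmetric (adj G).
Proof.
by move=> x y; case/andP: (adjf_simple G) => _ /forallP/(_ x)/forallP/(_ y)/eqP.
Qed.

Definition pullback (T W : finType) (G : sgraph T) (f : W -> T) : sgraph W :=
  mk_sgraph (fun u => adj_irr G (f u)) (fun u w => adj_sym G (f u) (f w)).

Definition induced (T : finType) (G : sgraph T) (A : {set T}) :
  sgraph {x : T | x \in A} := pullback G val.

Definition graph_iso (T U : finType) (G : sgraph T) (H : sgraph U) : Prop :=
  exists f : T -> U, bijective f /\ forall x y, adj H (f x) (f y) = adj G x y.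

Definition Pcount (U T : finType) (F : sgraph U) (G : sgraph T) : nat :=
  #|[pred A : {set T} | (#|A| == #|U|) && `[< graph_iso F (induced G A) >]]|.

(* With V_i = c^-1(i), this is the blow-up B(V_1,...,V_m) on the vertex set T;
   parts may be empty. *)
Definition blowup (m : nat) (T : finType) (B : sgraph 'I_m) (c : T -> 'I_m) :
  sgraph T := pullback B c.

Definition blowup_parts (m : nat) (B : sgraph 'I_m) (V : 'I_m -> finType) :
  sgraph {i : 'I_m & V i} := blowup B (fun u => tag u).

Definition is_blowup (m : nat) (B : sgraph 'I_m) (T : finType) : set (sgraph T) :=
  [set G | exists c : T -> 'I_m, G = blowup B c].

(* Number of adjacency changes between two graphs on the same vertex set; each
   unordered pair occurs twice among the ordered ones, hence the halving. *)
Definition nb_changes (T : finType) (G H : sgraph T) : nat :=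
  #|[pred p : T * T | adj G p.1 p.2 != adj H p.1 p.2]|./2.

Definition complete_graph (n : nat) : sgraph 'I_n.
Proof.
refine (@mk_sgraph 'I_n (fun x y => x != y) _ _).
- by move=> x; rewrite eqxx.
- by move=> x y; rewrite eq_sym.
Defined.

Definition complete_bipartite (a b : nat) : sgraph 'I_(a + b).
Proof.
refine (@mk_sgraph 'I_(a + b) (fun x y => (x < a)%N != (y < a)%N) _ _).
- by move=> x; rewrite eqxx.
- by move=> x y; rewrite eq_sym.
Defined.

(* A chosen representative of the isomorphism class of H: [choose] depends only
   on the extent of the predicate, so isomorphic graphs get the same one. *)
Definition iso_repr (k : nat) (H : sgraph 'I_k) : sgraph 'I_k :=
  choose (fun H' : sgraph 'I_k => `[< graph_iso H H' >]) H.

(* A family of forbidden graphs, each given on some vertex set 'I_k. *)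
Definition graph_family := forall k : nat, set (sgraph 'I_k).

Definition no_forbidden : graph_family := fun k => set0.

Definition admissible (Fam : graph_family) (T : finType) : set (sgraph T) :=
  [set G | forall (k : nat) (F : sgraph 'I_k), Fam k F ->
             forall A : {set T}, ~ graph_iso F (induced G A)].

Section Problem.
Variable R : realType.

(* The order kappa is the parameter k of gamma; gamma is meant to be invariant
   under isomorphism, and the sum has one term per isomorphism class. *)
Definition Lambda (k : nat) (gamma : sgraph 'I_k -> R)
    (T : finType) (G : sgraph T) : R :=
  \sum_(H : sgraph 'I_k | iso_repr H == H) gamma H * (Pcount H G)%:R.

Definition lambda (k : nat) (gamma : sgraph 'I_k -> R)
    (T : finType) (G : sgraph T) : R :=
  Lambda gamma G / 'C(#|T|, k)%:R.

(* The supremum is over a finite set, hence a maximum. *)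
Definition lambda_max (Fam : graph_family) (k : nat) (gamma : sgraph 'I_k -> R)
    (n : nat) : R :=
  sup [set lambda gamma G | G in @admissible Fam 'I_n].

Definition edit_dist (T : finType) (G : sgraph T) (m : nat) (B : sgraph 'I_m) : R :=
  inf [set ((nb_changes G H)%:R : R) | H in @is_blowup m B T] / 'C(#|T|, 2)%:R.

Definition perfectly_stable (Fam : graph_family) (k : nat)
    (gamma : sgraph 'I_k -> R) (m : nat) (B : sgraph 'I_m) : Prop :=
  exists C : R, 0 < C /\
    forall (T : finType) (G : sgraph T), admissible Fam G -> C <= #|T|%:R ->
      edit_dist G B <= C * (lambda_max Fam gamma #|T| - lambda gamma G).

Definition simplex (m : nat) : set 'rV[R]_m :=
  [set a | (forall i, 0 <= a 0 i) /\ \sum_i a 0 i = 1].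

Definition is_blowup_limit (k : nat) (gamma : sgraph 'I_k -> R) (m : nat)
    (B : sgraph 'I_m) (a : 'rV[R]_m) : set R :=
  [set l | forall V : nat -> 'I_m -> finType,
     (exists K : R, forall n i, `| #|V n i|%:R - a 0 i * n%:R | <= K) ->
     (fun n => lambda gamma (blowup_parts B (V n))) @ \oo --> l].

(* lambda(B(a)): the common limit along all admissible choices of parts. *)
Definition blowup_lambda (k : nat) (gamma : sgraph 'I_k -> R) (m : nat)
    (B : sgraph 'I_m) (a : 'rV[R]_m) : R :=
  get (is_blowup_limit gamma B a).

Definition is_maximiser (k : nat) (gamma : sgraph 'I_k -> R) (m : nat)
    (B : sgraph 'I_m) (a : 'rV[R]_m) : Prop :=
  @simplex m a /\
  forall b, @simplex m b -> blowup_lambda gamma B b <= blowup_lambda gamma B a.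

Definition gamma_ind (k : nat) (F H : sgraph 'I_k) : R :=
  if `[< graph_iso H F >] then 1 else 0.

End Problem.

(* Main.v *)
(** Every induced K_{3,2} contains three induced 4-cycles and every induced
    4-cycle extends to at most n - 4 copies of K_{3,2}, with equality in
    complete bipartite graphs; so it suffices to treat 4-cycles.  For an edge uv
    let A = N(v) \ N[u], B = N(u) \ N[v], and let t and z be the numbers of common
    neighbours and common non-neighbours.  The 4-cycles through uv are the edges
    between A and B, so there are |A| |B| - gaps(uv) of them, where
    |A| + |B| = n - 2 - t - z.  With c = 4M/n, M the number of 4-cycles of the
    balanced complete bipartite graph, one has
      |A| |B| + n (t + z) / 16 <= c / deg u + c / deg v,
    and the right-hand sides add up to at most 4M over all edges.  Hence the
    number of 4-cycles is at most M, and the deficit controls the sum over all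
    edges of gaps + n (t + z).  Finally the partition (N(u), V \ N(u)) makes G
    complete bipartite after at most n (t + z) + gaps changes, plus the edges
    inside N(u) and inside N(v); averaging over uv, the latter are counted by
    triangles, that is, by the sum of the t's. *)
Require Import Defs.
From mathcomp Require Import all_boot all_order all_algebra.
From mathcomp Require Import all_classical all_reals all_analysis.
From mathcomp Require Import zify ring lra.

Set Implicit Arguments.
Unset Strict Implicit.
Unset Printing Implicit Defensive.

Import Order.TTheory GRing.Theory Num.Theory.
Import numFieldNormedType.Exports.

Local Open Scope ring_scope.
Local Open Scope set_scope.

(** * Embeddings and induced copies *)

(** Labelled copies replace vertex subsets because explicit maps can be counted by injections and
    bijections; [card_emb] converts back to [Pcount]. *)
Definition emb (U T : finType) (F : sgraph U) (G : sgraph T) :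
    {set {ffun U -> T}} :=
  [set f : {ffun U -> T} | injectiveb f &
     [forall x, forall y, adj G (f x) (f y) == adj F x y]].

Lemma embP (U T : finType) (F : sgraph U) (G : sgraph T) (f : {ffun U -> T}) :
  reflect (injective f /\ forall x y, adj G (f x) (f y) = adj F x y)
          (f \in emb F G).
Proof.
rewrite inE; apply: (iffP andP) => [[/injectiveP fI fG]|[fI fG]]; split => //.
- by move=> x y; exact/eqP/(forallP (forallP fG x)).
- exact/injectiveP.
- by apply/forallP => x; apply/forallP => y; rewrite fG.
Qed.

Lemma graph_iso_induced (U T : finType) (F : sgraph U) (G : sgraph T)
    (A : {set T}) :
  graph_iso F (Defs.induced G A) <-> exists2 f, f \in emb F G & f @: [set: U] = A.
Proof.
split=> [[f [fb fG]]|[f /embP[fI fG] fA]].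
- exists [ffun x => val (f x)].
    apply/embP; split=> [x y|x y]; rewrite !ffunE.
      by move=> /val_inj /(bij_inj fb).
    by rewrite -fG adj_mk.
  apply/setP => y; apply/imsetP/idP => [[x _ ->]|yA].
    by rewrite ffunE; exact: (valP (f x)).
  case: fb => g _ gK; exists (g (exist _ y yA)).
    by rewrite inE.
  by rewrite ffunE gK.
- have fin x : f x \in A by rewrite -fA imset_f.
  pose g (x : U) : {x | x \in A} := exist _ (f x) (fin x).
  exists g; split; last first.
    by move=> x y; rewrite adj_mk fG.
  apply: inj_card_bij => [x y [/fI]//|].

  by rewrite card_sig -fA card_imset ?cardsT.
Qed.

(* The embeddings with a given image are the automorphisms of F followed by any
   one of them. *)
Lemma card_emb (U T : finType) (F : sgraph U) (G : sgraph T) :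
  #|emb F G| = (#|emb F F| * Pcount F G)%N.
Proof.
rewrite [LHS](eq_card (B := [set f in emb F G])); last by move=> f; rewrite inE.
rewrite -sum1_card.
rewrite (partition_big (fun f : {ffun U -> T} => f @: [set: U])
  (fun A => (#|A| == #|U|) && `[< graph_iso F (Defs.induced G A) >])) /=; last first.
  move=> f; rewrite inE => fE; apply/andP; split.
    by have /embP[fI _] := fE; rewrite card_imset// cardsT.
  by apply/asboolP/graph_iso_induced; exists f.
rewrite /Pcount -[X in (_ * X)%N]sum1_card big_distrr /=; apply: eq_bigr => A.
move=> /andP[_ /asboolP /graph_iso_induced[f0 /[dup] f0E /embP[f0I f0G] f0A]].
rewrite muln1 sum1dep_card.
pose h (s : {ffun U -> U}) : {ffun U -> T} := [ffun x => f0 (s x)].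
have hI : injective h.
  move=> s s' /ffunP ss'; apply/ffunP => x.
  by have := ss' x; rewrite !ffunE => /f0I.
rewrite -(card_imset _ hI); apply: eq_card => f; rewrite inE.
apply/andP/imsetP => [[]|[s /embP[sI sF] ->]].
- rewrite inE => /embP[fI fG] /eqP fA.
  have inv x : exists y, f0 y == f x.
    have : f x \in f0 @: [set: U] by rewrite f0A -fA imset_f.
    by case/imsetP => y _ ->; exists y.
  (* The maps [f] and [f0] have the same image, so f = f0 o s, where s is [f] followed by the
     inverse of [f0]. *)
  pose s := [ffun x => xchoose (inv x)].
  have sK x : f0 (s x) = f x by rewrite ffunE; exact/eqP/(xchooseP (inv x)).
  exists s; last by apply/ffunP => x; rewrite ffunE sK.
  apply/embP; split=> [x y sxy|x y]; first by apply: fI; rewrite -!sK sxy.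
  by rewrite -f0G !sK fG.
- split.
    rewrite inE; apply/embP; split=> [x y|x y]; rewrite !ffunE.
      by move=> /f0I /sI.
    by rewrite f0G sF.
  apply/eqP; rewrite -f0A; apply/setP => y.
  have sb := injF_bij sI.
  apply/imsetP/imsetP => -[x _ ->].
    by exists (s x); rewrite ?inE ?ffunE.
  by case: sb => s' _ s'K; exists (s' x); rewrite ?inE ?ffunE ?s'K.
Qed.

Lemma graph_iso_refl (T : finType) (G : sgraph T) : graph_iso G G.
Proof. by exists id; split=> //; exists id. Qed.

Lemma graph_iso_sym (T U : finType) (G : sgraph T) (H : sgraph U) :
  graph_iso G H -> graph_iso H G.
Proof.
move=> [f [[g fK gK] fG]]; exists g; split; first by exists f.
by move=> x y; rewrite -fG !gK.
Qed.

Lemma graph_iso_trans (T U W : finType) (G : sgraph T) (H : sgraph U)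
    (K : sgraph W) : graph_iso G H -> graph_iso H K -> graph_iso G K.
Proof.
move=> [f [fb fG]] [g [gb gH]]; exists (g \o f); split; first exact: bij_comp.
by move=> x y; rewrite /= gH fG.
Qed.

Lemma eq_Pcount (U U' T : finType) (F : sgraph U) (F' : sgraph U')
    (G : sgraph T) : graph_iso F F' -> Pcount F G = Pcount F' G.
Proof.
move=> FF'; have F'F := graph_iso_sym FF'; apply: eq_card => A; rewrite !inE.
have -> : #|U| = #|U'| by case: FF' => f [/bij_eq_card].
by congr (_ && _); apply/asboolP/asboolP; apply: graph_iso_trans.
Qed.

Lemma iso_reprP (k : nat) (H : sgraph 'I_k) : graph_iso H (iso_repr H).
Proof.
apply/asboolP; apply: (@chooseP _ (fun H' => `[< graph_iso H H' >])).
exact/asboolP/graph_iso_refl.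
Qed.

Lemma iso_repr_eq (k : nat) (H K : sgraph 'I_k) :
  graph_iso H K -> iso_repr H = iso_repr K.
Proof.
move=> HK; have KH := graph_iso_sym HK; rewrite /iso_repr.
have HKE : (fun H' : sgraph 'I_k => `[< graph_iso H H' >]) =1
           (fun H' => `[< graph_iso K H' >]).
  by move=> L; apply/asboolP/asboolP; apply: graph_iso_trans.
rewrite (eq_choose HKE); apply: choose_id; apply/asboolP => //.
exact: graph_iso_refl.
Qed.

(** Only the representative of the class of [F] has nonzero weight, so the sum collapses to one
    term. *)
Lemma Lambda_gamma_ind (R : realType) (k : nat) (F : sgraph 'I_k)
    (T : finType) (G : sgraph T) :
  Lambda (gamma_ind R F) G = (Pcount F G)%:R.
Proof.
rewrite /Lambda (bigD1 (iso_repr F)) /=; last first.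
  by apply/eqP; apply: iso_repr_eq; apply: graph_iso_sym; apply: iso_reprP.
rewrite big1 => [|H /andP[/eqP HH HF]].
  have FF := iso_reprP F.
  rewrite addr0 /gamma_ind asboolT ?mul1r; last exact: graph_iso_sym.
  by rewrite (eq_Pcount G FF).
rewrite /gamma_ind asboolF ?mul0r// => HF'; case/eqP: HF.
by rewrite -(iso_repr_eq HF') HH.
Qed.

(** * Copies of complete bipartite graphs in blow-ups of K_2 *)

Lemma adj_blowup_K2 (T : finType) (c : T -> 'I_2) (u w : T) :
  let X := [set x | c x == ord0] in
  adj (blowup (complete_graph 2) c) u w = ((u \in X) != (w \in X)).
Proof.
rewrite /= !inE /blowup /pullback adj_mk /complete_graph adj_mk.
by case: (c u) => [[|[|?]] ?] //; case: (c w) => [[|[|?]] ?].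
Qed.

(** The side that receives the first vertex of the a-part decides the side of every other vertex. An
    embedding is thus a pair of injections into opposite sides, in one of two disjoint ways. *)
Lemma card_emb_complete_bipartite (a b : nat) (T : finType) (c : T -> 'I_2) :
  let X := [set x | c x == ord0] in
  (0 < a)%N -> (0 < b)%N ->
  #|emb (complete_bipartite a b) (blowup (complete_graph 2) c)| =
  (#|X| ^_ a * #|~: X| ^_ b + #|~: X| ^_ a * #|X| ^_ b)%N.
Proof.
move=> X a0 b0.
pose I k (A : {set T}) :=
  [set f : {ffun 'I_k -> T} in ffun_on (mem A) | injectiveb f].
have cardI k A : #|I k A| = #|A| ^_ k by rewrite card_inj_ffuns_on card_ord.
have II k (A : {set T}) (f : {ffun 'I_k -> T}) :
    reflect ((forall i, f i \in A) /\ injective f) (f \in I k A).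
  rewrite inE; apply: (iffP andP) => -[fA fI].
    by split; [exact/ffun_onP | exact/injectiveP].
  by split; [exact/ffun_onP | exact/injectiveP].
pose h (f : {ffun 'I_(a + b) -> T}) : {ffun 'I_a -> T} * {ffun 'I_b -> T} :=
  ([ffun i => f (lshift b i)], [ffun j => f (rshift a j)]).
have hI : injective h.
  move=> f f' [/ffunP ff1 /ffunP ff2]; apply/ffunP => x.
  case: (split_ordP x) => i ->; first by have := ff1 i; rewrite !ffunE.
  by have := ff2 i; rewrite !ffunE.
pose i0 : 'I_a := Ordinal a0.
have ltr (j : 'I_b) : (rshift a j < a)%N = false.
  by rewrite /= ltnNge leq_addr.
have adjE := adj_blowup_K2 c; rewrite -/X /= in adjE.
have mix (A : {set T}) g k : A = X \/ A = ~: X ->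
    g \in I a A -> k \in I b (~: A) ->
    exists2 f, f \in emb (complete_bipartite a b) (blowup (complete_graph 2) c)
      & (g, k) = h f.
  move=> AX /II[gA gI] /II[kA kI].
  pose f : {ffun 'I_(a + b) -> T} :=
    [ffun x => match fintype.split x with inl i => g i | inr j => k j end].
  have fl i : f (lshift b i) = g i.
    by rewrite ffunE -[lshift b i]/(unsplit (inl i)) unsplitK.
  have fr j : f (rshift a j) = k j.
    by rewrite ffunE -[rshift a j]/(unsplit (inr j)) unsplitK.
  have adjA u w : adj (blowup (complete_graph 2) c) u w =
      ((u \in A) != (w \in A)).
    rewrite adjE; case: AX => ->//.
    by rewrite !inE; case: (c u == _); case: (c w == _).
  exists f; last by congr pair; apply/ffunP => i; rewrite ffunE ?fl ?fr.
  apply/embP; split=> x y; case: (split_ordP x) => i ->;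
    case: (split_ordP y) => j ->; rewrite ?fl ?fr.
  - by move=> /gI ->.
  - by move=> gk; have := kA j; rewrite -gk inE gA.
  - by move=> gk; have := kA i; rewrite gk inE gA.
  - by move=> /kI ->.
  - by rewrite adjA !gA adj_mk /= !ltn_ord.
  - by rewrite adjA gA adj_mk ltr /= ltn_ord; have := kA j; rewrite inE => /negbTE->.
  - by rewrite adjA gA adj_mk ltr /= ltn_ord; have := kA i; rewrite inE => /negbTE->.
  - rewrite adjA adj_mk !ltr; have := kA i; have := kA j; rewrite !inE.
    by move=> /negbTE-> /negbTE->.
rewrite -!cardI -!cardsX -(card_imset _ hI).
rewrite -[RHS]cardsUI [X in _ = (_ + X)%N](_ : _ = 0)%N ?addn0; last first.
  apply/eqP; rewrite cards_eq0; apply/eqP/setP => -[g k].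
  rewrite !inE /=; apply/negP => /andP[/andP[/andP[/ffun_onP gX _] _]].
  move=> /andP[/andP[/ffun_onP gY _] _].
  by have := gY i0; rewrite inE gX.
apply: eq_card => -[g k]; apply/imsetP/idP => [[f /embP[fI fG] ->]|].
- have lX i : (f (lshift b i) \in X) = (f (lshift b i0) \in X).
    by apply/eqP/negbNE; rewrite -adjE fG adj_mk /= ltn_ord a0.
  have rX j : (f (rshift a j) \in X) = ~~ (f (lshift b i0) \in X).
    have := fG (rshift a j) (lshift b i0).
    by rewrite adjE adj_mk ltr /= a0 /=; case: (_ \in X); case: (_ \in X).
  have lI : injective [ffun x => f (lshift b x)].
    by move=> i j; rewrite !ffunE => /fI /lshift_inj.
  have rI : injective [ffun x => f (rshift a x)].
    by move=> i j; rewrite !ffunE => /fI /rshift_inj.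
  rewrite !finset.in_setU !finset.in_setX /=; apply/orP.
  have [fX|fX] := boolP (f (lshift b i0) \in X); [left|right];
    apply/andP; split; apply/II; split=> // l; rewrite ffunE ?finset.in_setC ?lX ?rX fX//.
- rewrite finset.in_setU !finset.in_setX /= => /orP[] /andP[gI kI].
    by apply: mix gI kI; left.
  by apply: mix gI _; [right | rewrite finset.setCK].
Qed.

(** * Induced 4-cycles through an edge *)

(** For an edge uv, the sets A and B of the overview are [priv G v u] and [priv G u v]; t and z are
    the sizes of [common G u v] and [noncommon G u v]. *)
Definition priv (T : finType) (G : sgraph T) (u v : T) : {set T} :=
  [set w | [&& adj G u w, ~~ adj G v w & w != v]].

Definition common (T : finType) (G : sgraph T) (u v : T) : {set T} :=
  [set w | adj G u w && adj G v w].

Definition noncommon (T : finType) (G : sgraph T) (u v : T) : {set T} :=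
  [set w | [&& ~~ adj G u w, ~~ adj G v w, w != u & w != v]].

Definition deg (T : finType) (G : sgraph T) (u : T) : nat := #|[set w | adj G u w]|.

(* The pairs (w, z) such that u, v, w, z induce a 4-cycle in this order. *)
Definition squares (T : finType) (G : sgraph T) (u v : T) : {set T * T} :=
  [set p | [&& p.1 \in priv G v u, p.2 \in priv G u v & adj G p.1 p.2]].

Definition gaps (T : finType) (G : sgraph T) (u v : T) : {set T * T} :=
  [set p | [&& p.1 \in priv G v u, p.2 \in priv G u v & ~~ adj G p.1 p.2]].

(** The sum runs over oriented edges, so each induced 4-cycle is counted 8 times. *)
Definition nb_squares (T : finType) (G : sgraph T) : nat :=
  \sum_(e : T * T | adj G e.1 e.2) #|squares G e.1 e.2|.

Lemma commonC (T : finType) (G : sgraph T) (u v : T) :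
  common G u v = common G v u.
Proof. by apply/setP => w; rewrite !inE andbC. Qed.

Lemma card_squares_gaps (T : finType) (G : sgraph T) (u v : T) :
  (#|squares G u v| + #|gaps G u v| = #|priv G v u| * #|priv G u v|)%N.
Proof.
rewrite -cardsX -[RHS](cardsID (squares G u v)); congr (_ + _)%N.
  by apply: eq_card => -[w z]; rewrite !inE /=; do 5!case: (adj G _ _);
     case: (w == u); case: (z == v).
apply: eq_card => -[w z]; rewrite !inE /=.
by do 5!case: (adj G _ _); case: (w == u); case: (z == v).
Qed.

Lemma deg_priv (T : finType) (G : sgraph T) (u v : T) :
  adj G u v -> deg G u = (#|priv G u v| + #|common G u v| + 1)%N.
Proof.
move=> uv; rewrite /deg -(cardsID [set v]) addnC; congr (_ + _)%N; last first.
  by rewrite (_ : _ :&: _ = [set v]) ?cards1//; apply/setP => w;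
     rewrite !inE; case: eqP => [->|]; rewrite ?uv ?andbF.
rewrite -(cardsID (common G u v)) addnC; congr (_ + _)%N.
  apply: eq_card => w; rewrite !inE.
  by do 2!case: (adj G _ w); case: eqP.
apply: eq_card => w; rewrite !inE.
have [->|] := eqVneq w v; first by rewrite adj_irr uv.
by do 2!case: (adj G _ w).
Qed.

Lemma card_vertices (T : finType) (G : sgraph T) (u v : T) : adj G u v ->
  #|T| = (#|priv G v u| + #|priv G u v| + #|common G u v| +
          #|noncommon G u v| + 2)%N.
Proof.
move=> uv; have uDv : u != v by apply: contraTneq uv => ->; rewrite adj_irr.
have -> : #|T| = (deg G u + #|~: [set w | adj G u w]|)%N.
  by rewrite cardsC.
rewrite (deg_priv uv).
suff -> : #|~: [set w | adj G u w]| = (#|priv G v u| + #|noncommon G u v| + 1)%N.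
  by lia.
rewrite -(cardsID [set u]) addnC; congr (_ + _)%N; last first.
  by rewrite (_ : _ :&: _ = [set u]) ?cards1//; apply/setP => w;
     rewrite !inE; case: eqP => [->|]; rewrite ?adj_irr ?andbF.
rewrite -(cardsID (priv G v u)); congr (_ + _)%N.
  by apply: eq_card => w; rewrite !inE; do 2!case: (adj G _ w); case: eqP.
apply: eq_card => w; rewrite !inE.
have [->|wv] := eqVneq w v; first by rewrite uv /= ?andbF.
by do 2!case: (adj G _ w); case: (w == u).
Qed.

(* An induced K_{3,2} yields 12 embeddings but 24 pairs consisting of a labelled
   4-cycle and a fifth vertex, as the cycle may start on either side: hence the
   two maps indexed by a boolean. *)
Lemma card_emb_K32 (T : finType) (G : sgraph T) :
  (2 * #|emb (complete_bipartite 3 2) G| <= nb_squares G * (#|T| - 4))%N.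
Proof.
pose Q : {set (T * T) * (T * T)} :=
  [set q | adj G q.1.1 q.1.2 && (q.2 \in squares G q.1.1 q.1.2)].
pose cyc (q : (T * T) * (T * T)) : {set T} :=
  [set q.1.1; q.1.2; q.2.1; q.2.2].
have <- : #|Q| = nb_squares G.
  rewrite -sum1_card /nb_squares.
  under [RHS]eq_bigr do rewrite -sum1_card.
  by rewrite pair_big_dep; apply: eq_bigl => q; rewrite inE.
pose D : {set (T * T) * (T * T) * T} := [set x | (x.1 \in Q) && (x.2 \notin cyc x.1)].
have -> : (#|Q| * (#|T| - 4) = #|D|)%N.
  rewrite -[#|Q|]sum1_card big_distrl /= -[#|D|]sum1_card.
  under [RHS]eq_bigl do rewrite inE.
  rewrite -(pair_big_dep (mem Q) (fun q y => y \notin cyc q) (fun _ _ => 1%N)) /=.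
  apply: eq_bigr => -[[u v] [w z]]; rewrite mul1n sum1dep_card => qQ.
  have -> : #|[set y | y \notin cyc (u, v, (w, z))]| = #|~: cyc (u, v, (w, z))|.
    by apply: eq_card => y; rewrite !inE.
  rewrite cardsCs finset.setCK; congr (_ - _)%N.
  move: qQ; rewrite inE /= /squares !inE /=.
  move=> /and3P[uv /and3P[vw uw wu] /andP[/and3P[uz vz zv] wz]].
  have neq x y : adj G x y -> (x == y) = false.
    by move=> xy; apply: contraTF xy => /eqP->; rewrite adj_irr.
  rewrite /cyc /= -!finset.setUA !cardsU1 cards1 !inE.
  by rewrite (neq _ _ uv) (neq _ _ uz) (neq _ _ vw) (neq _ _ wz)
    [u == w]eq_sym (negbTE wu) [v == z]eq_sym (negbTE zv).
pose o k (kl : (k < 5)%N) := Ordinal kl.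
pose o0 := o 0%N isT; pose o1 := o 1%N isT; pose o2 := o 2%N isT.
pose o3 := o 3%N isT; pose o4 := o 4%N isT.
pose h (x : {ffun 'I_(3 + 2) -> T} * bool) : (T * T) * (T * T) * T :=
  let f := x.1 in
  if x.2 then ((f o0, f o3), (f o1, f o4), f o2)
  else ((f o3, f o0), (f o4, f o1), f o2).
pose E := emb (complete_bipartite 3 2) G.
have EP f : f \in E -> injective f /\
    (forall i j, adj G (f i) (f j) = ((i < 3)%N != (j < 3)%N)).
  by move=> /embP[fI fG]; split => // i j; rewrite fG adj_mk.
have hI : {in finset.setX E [set: bool] &, injective h}.
  move=> [f b] [f' b']; rewrite !finset.in_setX /= => /andP[/EP[fI fG] _].
  move=> /andP[/EP[fI' fG'] _].
  have ext : f o0 = f' o0 -> f o1 = f' o1 -> f o2 = f' o2 -> f o3 = f' o3 ->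
      f o4 = f' o4 -> f = f'.
    move=> e0 e1 e2 e3 e4; apply/ffunP => -[[|[|[|[|[|//]]]]] il].
    - by rewrite (_ : Ordinal il = o0)//; apply: val_inj.
    - by rewrite (_ : Ordinal il = o1)//; apply: val_inj.
    - by rewrite (_ : Ordinal il = o2)//; apply: val_inj.
    - by rewrite (_ : Ordinal il = o3)//; apply: val_inj.
    - by rewrite (_ : Ordinal il = o4)//; apply: val_inj.
  (* If the booleans differ, the images differ: the fifth vertex is nonadjacent to the first vertex
     of the cycle for [true] and adjacent to it for [false]. *)
  case: b; case: b'; rewrite /h /= => -[e0 e3 e1 e4 e2].
  - by rewrite (ext e0 e1 e2 e3 e4).
  - by have := fG o2 o0; rewrite e2 e0 fG'.
  - by have := fG o2 o3; rewrite e2 e0 fG'.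
  - by rewrite (ext e3 e4 e2 e0 e1).
have -> : (2 * #|E| = #|finset.setX E [set: bool]|)%N.
  by rewrite cardsX cardsT card_bool mulnC.
rewrite -(card_in_imset hI).
apply/subset_leq_card/fintype.subsetP => _ /imsetP[[f b] fE ->].
move: fE; rewrite finset.in_setX /= => /andP[/EP[fI fG] _].
by case: b; rewrite /h /= !inE /= !fG !(inj_eq fI).
Qed.

(** * The weight inequality for one edge *)

(* Four times the number of 4-cycles in the balanced complete bipartite graph. *)
Definition balanced (n : nat) : nat := (n./2 ^_ 2 * uphalf n ^_ 2)%N.

Lemma ffact2 (n : nat) : (n ^_ 2 = n * n.-1)%N.
Proof. by rewrite ffactnS ffactn1. Qed.

(** Regroup the product as xy times (x - 1)(y - 1): for positive x and y, both factors are products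
    of two numbers with fixed sum, hence largest for the balanced split. *)
Lemma ffact2_leq_balanced (x y : nat) :
  (x ^_ 2 * y ^_ 2 <= balanced (x + y))%N.
Proof.
rewrite /balanced uphalf_half; move: (odd_double_half (x + y)).
move: (x + y)./2 => m; case: (odd _) => /= mE; rewrite !ffact2.
  rewrite mulnACA [leqRHS]mulnACA.
  have xy : (x * y <= m * (1 + m))%N.
    by case: (leqP x m) => ?; nia.
  apply: leq_mul => //.
  by case: x y m mE xy => [|x] [|y] [|m] //=; nia.
rewrite mulnACA [leqRHS]mulnACA.
have xy : (x * y <= m * m)%N by case: (leqP x m) => ?; nia.
apply: leq_mul => //.
by case: x y m mE xy => [|x] [|y] [|m] //=; nia.
Qed.

Lemma natr_ffact2 (R : realFieldType) (n : nat) :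
  (n ^_ 2)%:R = n%:R * (n%:R - 1) :> R.
Proof.
by case: n => [|n]; rewrite ffact2 ?mul0r// natrM /= -natr1 addrK.
Qed.

Lemma natr_ffact4 (R : realFieldType) (n : nat) :
  (n ^_ 4)%:R = n%:R * (n%:R - 1) * (n%:R - 2) * (n%:R - 3) :> R.
Proof.
have [n4|n4] := ltnP n 4.
  by rewrite ffact_small//; case: n n4 => [|[|[|[|//]]]] _; ring.
rewrite (ffactnSr _ 3) (natrM _ (_ ^_ 3)) (ffactnSr _ 2) (natrM _ (_ ^_ 2)).
by rewrite natr_ffact2 !natrB//; lia.
Qed.

Lemma natr_half (R : realFieldType) (n : nat) :
  n%:R = (odd n)%:R + 2 * (n./2)%:R :> R.
Proof. by rewrite -{1}(odd_double_half n) natrD -muln2 natrM mulrC. Qed.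

Lemma natr_balanced (R : realFieldType) (n : nat) :
  (balanced n)%:R = if odd n then (n%:R - 1) ^+ 2 * (n%:R - 3) * (n%:R + 1) / 16
                    else n%:R ^+ 2 * (n%:R - 2) ^+ 2 / 16 :> R.
Proof.
rewrite natrM !natr_ffact2 uphalf_half natrD (natr_half R n).
by case: (odd n) => /=; field.
Qed.

(** A bound common to both parities. With s = n(n - 2), 16 [balanced n] is s^2 for even n and s^2 -
    2s - 3 for odd n, while the left-hand side is s^2 - 2n^2. *)
Lemma balanced_ge (R : realFieldType) (n : nat) : (8 <= n)%N ->
  n%:R ^+ 2 * ((n%:R - 2) ^+ 2 - 2) <= 16 * (balanced n)%:R :> R.
Proof.
move=> n8; have {n8} : 8 <= n%:R :> R by rewrite (ler_nat _ 8).
rewrite natr_balanced; move: (n%:R : R) => x x8; case: odd; nra.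
Qed.

(* By AM-HM the right-hand side is at least 4 balanced(n) / (n (n + t - z)), while
   a b <= ((n - 2 - t - z) / 2)^2; equality can only hold for t = z = 0, where
   integrality matters for odd n. *)
Lemma edge_weight (R : realFieldType) (n a b t z : nat) :
  (8 <= n)%N -> n = (a + b + t + z + 2)%N ->
  (a * b)%:R + n%:R * (t + z)%:R / 16 <=
  (balanced n)%:R / n%:R * ((b + t + 1)%:R^-1 + (a + t + 1)%:R^-1) :> R.
Proof.
move=> n8 nE.
have [tz0|tz1] := posnP (t + z).
  have [t0 z0] : t = 0%N /\ z = 0%N by lia.
  subst t z; rewrite !addn0 mulr0 mul0r addr0.
  (* Here n = (a + 1) + (b + 1), and the claim reduces to ab(a + 1)(b + 1) <= [balanced n], with no
     room to spare. *)
  have := ffact2_leq_balanced (b + 1) (a + 1).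
  rewrite (_ : (b + 1 + (a + 1))%N = n); last by lia.
  rewrite -(ler_nat R); move: (balanced n) => B.
  rewrite (natrM _ (_ ^_ 2)) (natrM _ a b) !natr_ffact2 !natrD !addrK.
  have -> : n%:R = (a%:R + 1) + (b%:R + 1) :> R by rewrite nE !natrD; ring.
  have : 0 <= a%:R :> R by []. have : 0 <= b%:R :> R by [].
  move: (a%:R : R) (b%:R : R) (B%:R : R) => x y {}B y0 x0 H.
  have -> : B / (x + 1 + (y + 1)) * ((y + 1)^-1 + (x + 1)^-1) =
      B / ((x + 1) * (y + 1)).
    by field; rewrite ?gt_eqF//; lra.
  rewrite ler_pdivlMr; first by lra.
  by rewrite mulr_gt0//; lra.
have := @balanced_ge R n n8; move: (balanced n) => B.
have : 0 <= a%:R :> R by []. have : 0 <= b%:R :> R by [].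
have : 0 <= t%:R :> R by []. have : 0 <= z%:R :> R by [].
have : 1 <= t%:R + z%:R :> R by rewrite -natrD (ler_nat _ 1).
have : 8 <= n%:R :> R by rewrite (ler_nat _ 8).
have : n%:R = a%:R + b%:R + t%:R + z%:R + 2 :> R by rewrite nE !natrD.
rewrite (natrM _ a b) !natrD.
move: (a%:R : R) (b%:R : R) (t%:R : R) (z%:R : R) (n%:R : R) (B%:R : R).
move=> {tz1 nE n8} {}a {}b {}t {}z {}n {}B nE n8 k1 z0 t0 b0 a0 HB.
(* The two degrees sum to n + t - z; this is weakened to n + t + z so that only k = t + z
   remains. *)
have amhm : 4 / (n + (t + z)) <= (b + t + 1)^-1 + (a + t + 1)^-1.
  have -> : (b + t + 1)^-1 + (a + t + 1)^-1 =
      (a + b + 2 * t + 2) / ((b + t + 1) * (a + t + 1)).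
    by field; rewrite ?gt_eqF//; lra.
  rewrite ler_pdivrMr; last by lra.
  rewrite mulrAC ler_pdivlMr; last by rewrite mulr_gt0//; lra.
  have : 0 <= (a - b) ^+ 2 by exact: sqr_ge0.
  nra.
pose k := t + z.
have k1' : 1 <= k by [].
have kn : k <= n - 2 by rewrite /k; lra.
have abk : a * b <= (n - 2 - k) ^+ 2 / 4.
  have -> : n - 2 - k = a + b by rewrite /k; lra.
  have : 0 <= (a - b) ^+ 2 by exact: sqr_ge0.
  nra.
have Bn : n * ((n - 2) ^+ 2 - 2) / 16 <= B / n.
  rewrite ler_pdivlMr; last by lra.
  nra.
(* The claim after substituting the three bounds and clearing denominators. It fails for k = 0: k >=
   1 pays for the correction -2 from [balanced_ge]. *)
have key : (n + k) * (n - 2 - k) ^+ 2 + n * k * (n + k) / 4 <=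
    n * ((n - 2) ^+ 2 - 2).
  have e1 : 0 <= k ^+ 2 * (n - 2 - k) by rewrite mulr_ge0 ?sqr_ge0//; lra.
  have e2 : 0 <= k * (n - 2 - k) by rewrite mulr_ge0; lra.
  have e3 : 0 <= n * (k - 1) by rewrite mulr_ge0; lra.
  have e4 : 0 <= n * k * (n - 8) by rewrite !mulr_ge0; lra.
  have e5 : 0 <= n * k * (n - k) by rewrite !mulr_ge0; lra.
  lra.
rewrite -/k in amhm *.
apply: (@le_trans _ _ (n * ((n - 2) ^+ 2 - 2) / 16 * (4 / (n + k)))); last first.
  apply: ler_pM => //; last by rewrite divr_ge0//; lra.
  by rewrite divr_ge0// mulr_ge0//; nra.
rewrite mulrA ler_pdivlMr; last by lra.
nra.
Qed.

(** * Editing to a complete bipartite graph *)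

Definition changes (T : finType) (G H : sgraph T) : {set T * T} :=
  [set p | adj G p.1 p.2 != adj H p.1 p.2].

Lemma nb_changesE (T : finType) (G H : sgraph T) :
  nb_changes G H = #|changes G H|./2.
Proof. by congr _./2; apply: eq_card => p; rewrite !inE. Qed.

Definition links (T : finType) (G : sgraph T) (v : T) : {set T * T} :=
  [set p | [&& adj G v p.1, adj G v p.2 & adj G p.1 p.2]].

(** All counts are of ordered pairs. A wrong pair either meets the common neighbours or common
    non-neighbours, or is a gap in one of its two orders, or is an edge inside N(u) or N(v). *)
Lemma card_changes (T : finType) (G : sgraph T) (u v : T) : adj G u v ->
  exists2 H, is_blowup (complete_graph 2) H &
  (#|changes G H| <= 2 * (#|T| * (#|common G u v| + #|noncommon G u v|)) +
    2 * #|gaps G u v| + #|links G u| + #|links G v|)%N.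
Proof.
move=> uv; have vu : adj G v u by rewrite adj_sym.
pose c w : 'I_2 := if adj G u w then ord_max else ord0.
exists (blowup (complete_graph 2) c); first by exists c.
pose W := common G u v :|: noncommon G u v.
pose swap (p : T * T) := (p.2, p.1).
have swapI : injective swap by move=> [? ?] [? ?] [-> ->].
suff /subset_leq_card : changes G (blowup (complete_graph 2) c) \subset
    finset.setX W [set: T] :|: finset.setX [set: T] W :|:
    (gaps G u v :|: swap @: gaps G u v) :|: links G u :|: links G v.
  move=> /leq_trans; apply.
  do 2!(apply: leq_trans (leq_card_setU _ _) _; rewrite leq_add2r).
  apply: leq_trans (leq_card_setU _ _) _; apply: leq_add.
    apply: leq_trans (leq_card_setU _ _) _.
    rewrite !cardsX cardsT [(_ * #|T|)%N]mulnC addnn -mul2n.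
    by rewrite !leq_mul// leq_card_setU.
  by apply: leq_trans (leq_card_setU _ _) _; rewrite card_imset// addnn mul2n.
apply/fintype.subsetP => -[x y].
rewrite inE /= adj_blowup_K2 !inE /=.
have cE w : (c w == ord0) = ~~ adj G u w by rewrite /c; case: ifP.
rewrite !cE.
have -> : ((x, y) \in swap @: gaps G u v) = ((y, x) \in gaps G u v).
  by rewrite -[(x, y)]/(swap (y, x)) (mem_imset _ _ swapI).
rewrite !inE /= !andbT [adj G y x]adj_sym.
have [->|xu] := eqVneq x u; first by rewrite adj_irr; case: (adj G u y).
have [->|yu] := eqVneq y u.
  by rewrite adj_irr adj_sym; case: (adj G u x).
have [->|xv] := eqVneq x v.
  have [->|yv] := eqVneq y v; first by rewrite !adj_irr uv.
  by rewrite adj_irr uv; case: (adj G u y); case: (adj G v y).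
have [->|yv] := eqVneq y v.
  by rewrite adj_irr [adj G x v]adj_sym uv; case: (adj G u x); case: (adj G v x).
by case: (adj G u x); case: (adj G v x); case: (adj G u y); case: (adj G v y);
  case: (adj G x y).
Qed.

(** * Summation over edges *)

Lemma sum_edgesC (T : finType) (G : sgraph T) (M : nmodType) (F : T -> T -> M) :
  \sum_(e : T * T | adj G e.1 e.2) F e.1 e.2 =
  \sum_(e : T * T | adj G e.1 e.2) F e.2 e.1.
Proof.
pose swap (p : T * T) := (p.2, p.1).
have swapK : involutive swap by case.
rewrite (reindex_inj (inv_inj swapK)); apply: eq_bigl => -[x y] /=.
by rewrite adj_sym.
Qed.

Lemma card_links (T : finType) (G : sgraph T) (v : T) :
  #|links G v| = (\sum_(w | adj G v w) #|common G v w|)%N.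
Proof.
under eq_bigr do rewrite -sum1_card.
rewrite pair_big_dep -sum1_card /=; apply: eq_bigl => -[w x].
by rewrite !inE.
Qed.

(** The summand depends on the first endpoint u only, so it is repeated deg u <= n times;
    [card_links] expands it into codegrees. *)
Lemma sum_links (T : finType) (G : sgraph T) :
  (\sum_(e : T * T | adj G e.1 e.2) #|links G e.1| <=
   #|T| * \sum_(e : T * T | adj G e.1 e.2) #|common G e.1 e.2|)%N.
Proof.
rewrite -(pair_big_dep xpredT (adj G) (fun u _ => #|links G u|)).
rewrite -(pair_big_dep xpredT (adj G) (fun u v => #|common G u v|)) /=.
rewrite big_distrr /=; apply: leq_sum => u _.
by rewrite sum_nat_const -card_links leq_mul// max_card.
Qed.

(** Each vertex of positive degree contributes exactly 1. *)
Lemma sum_inv_deg (R : realFieldType) (T : finType) (G : sgraph T) :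
  \sum_(e : T * T | adj G e.1 e.2) (deg G e.1)%:R^-1 <= #|T|%:R :> R.
Proof.
rewrite -(pair_big_dep xpredT (adj G) (fun u _ => (deg G u)%:R^-1)) /=.
rewrite -sum1_card natr_sum; apply: ler_sum => u _.
rewrite sumr_const (_ : #|_| = deg G u); last first.
  by apply: eq_card => w; rewrite !inE.
rewrite -[_^-1 *+ _]mulr_natr; have [->|d0] := eqVneq (deg G u) 0%N; first by rewrite mulr0.
by rewrite mulVf// pnatr_eq0.
Qed.

(** Sum [edge_weight] over oriented edges: |A| |B| splits into squares and gaps, and the reciprocal
    degrees add up to at most 2n, which cancels the n in c. *)
Lemma sum_edge_loss (R : realFieldType) (T : finType) (G : sgraph T) :
  (8 <= #|T|)%N ->
  \sum_(e : T * T | adj G e.1 e.2) (#|gaps G e.1 e.2|%:R +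
     #|T|%:R * (#|common G e.1 e.2| + #|noncommon G e.1 e.2|)%:R / 16) <=
  2 * (balanced #|T|)%:R - (nb_squares G)%:R :> R.
Proof.
move=> n8; set c : R := (balanced #|T|)%:R / #|T|%:R.
have n0 : 0 < #|T|%:R :> R by rewrite ltr0n; lia.
have c0 : 0 <= c by rewrite divr_ge0.
rewrite lerBrDr /nb_squares natr_sum -big_split /=.
apply: (@le_trans _ _ (\sum_(e : T * T | adj G e.1 e.2)
    (c * ((deg G e.1)%:R^-1 + (deg G e.2)%:R^-1)))).
  apply: ler_sum => -[u v] /= uv.
  have := edge_weight R n8 (card_vertices uv).
  rewrite -card_squares_gaps natrD.
  rewrite -(deg_priv uv) commonC -deg_priv; last by rewrite adj_sym.
  by rewrite -/c commonC; lra.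
rewrite -mulr_sumr big_split /= -(sum_edgesC G (fun u v => (deg G u)%:R^-1)).
have -> : 2 * (balanced #|T|)%:R = c * (#|T|%:R + #|T|%:R) :> R.
  by rewrite /c; field; rewrite gt_eqF.
by rewrite ler_wpM2l// lerD// sum_inv_deg.
Qed.

Lemma nb_squares_le (T : finType) (G : sgraph T) : (8 <= #|T|)%N ->
  (nb_squares G <= 2 * balanced #|T|)%N.
Proof.
move=> n8; rewrite -(ler_nat rat) natrM -subr_ge0.
apply: le_trans (sum_edge_loss rat G n8); apply: sumr_ge0 => e _.
by rewrite addr_ge0// divr_ge0// mulr_ge0.
Qed.

(** Averaging [card_changes] over the edges works when there are at least n^2 / 8 oriented edges.
    With fewer edges, the deficit is already of order n^4 and a trivial bound on d suffices. *)
Lemma edit_le_loss (R : realFieldType) (T : finType) (G : sgraph T) (d : R) :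
  (8 <= #|T|)%N ->
  (forall H, is_blowup (complete_graph 2) H -> d <= (nb_changes G H)%:R) ->
  d * #|T|%:R ^+ 2 <=
  256 * (2 * (balanced #|T|)%:R - (nb_squares G)%:R).
Proof.
move=> n8 dH; set n : R := #|T|%:R; set W : R := (_ - _).
have n8R : 8 <= n by rewrite /n (ler_nat _ 8).
pose P : pred (T * T) := fun e => adj G e.1 e.2.
pose tz e := (#|common G e.1 e.2| + #|noncommon G e.1 e.2|)%N.
pose E := #|P|.
have Wloss : \sum_(e | P e) (#|gaps G e.1 e.2|%:R + n * (tz e)%:R / 16) <= W.
  exact: sum_edge_loss.
have halfR (k : nat) : (k./2)%:R <= k%:R / 2 :> R.
  by rewrite [in leRHS](natr_half R k); have : 0 <= (odd k)%:R :> R by []; lra.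
(* The changes add up to at most 2n (sum of t + z) plus the gaps; the factor 32 matches 2n against
   the n / 16 in [Wloss]. *)
have dE : E%:R * d <= 32 * W.
  have linkE : \sum_(e | P e) #|links G e.1|%:R + \sum_(e | P e) #|links G e.2|%:R
      <= 2 * n * \sum_(e | P e) (tz e)%:R :> R.
    have -> : \sum_(e | P e) #|links G e.2|%:R = \sum_(e | P e) #|links G e.1|%:R :> R.
      exact: (sum_edgesC G (fun _ v => #|links G v|%:R)).
    have le1 : \sum_(e | P e) #|links G e.1|%:R <=
        n * \sum_(e | P e) #|common G e.1 e.2|%:R.
      by rewrite -!natr_sum -natrM ler_nat sum_links.
    have le2 : \sum_(e | P e) #|common G e.1 e.2|%:R <= \sum_(e | P e) (tz e)%:R :> R.
      by apply: ler_sum => e _; rewrite ler_nat leq_addr.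
    have n0 : 0 <= n by [].
    nra.
  have sumd : \sum_(e | P e) d <= \sum_(e | P e)
      (n * (tz e)%:R + #|gaps G e.1 e.2|%:R +
       (#|links G e.1|%:R + #|links G e.2|%:R) / 2).
    apply: ler_sum => -[u v] /= uv; have [H HB] := card_changes uv.
    rewrite -(ler_nat R) => /le_trans - /(_ _ (lexx _)) chg.
    apply: le_trans (dH H HB) _; rewrite nb_changesE.
    apply: le_trans (halfR _) _; move: chg.
    by rewrite /tz /= !natrD !natrM -/n natrD; lra.
  rewrite sumr_const -[d *+ _]mulr_natl -/E in sumd.
  apply: le_trans sumd _; rewrite !big_split /= -mulr_sumr -mulr_suml big_split /=.
  move: Wloss; rewrite big_split /= -mulr_suml -mulr_sumr.
  have : 0 <= \sum_(e | P e) #|gaps G e.1 e.2|%:R :> R by apply: sumr_ge0.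
  by lra.
have [Ebig|Esmall] := leP (n ^+ 2 / 8) E%:R.
  (* As d is any lower bound, it may be negative; then W >= 0 is enough. *)
  have [d0|d0] := leP 0 d; first by nra.
  have W0 : 0 <= W.
    by rewrite subr_ge0 -natrM ler_nat nb_squares_le.
  by nra.
(* The blow-up with one part empty is the edgeless graph, at distance at most half the number of
   ordered pairs. *)
have dn : d <= n ^+ 2 / 2.
  pose c (_ : T) : 'I_2 := ord0.
  have /dH dc : is_blowup (complete_graph 2) (blowup (complete_graph 2) c).
    by exists c.
  apply: le_trans dc _; rewrite nb_changesE; apply: le_trans (halfR _) _.
  rewrite ler_pM2r ?invr_gt0// -natrX ler_nat.
  by apply: leq_trans (max_card _) _; rewrite card_prod.
(* Each oriented edge lies in at most |A| |B| <= ((n - 2) / 2)^2 squares. *)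
have sqE : (nb_squares G)%:R <= E%:R * ((n - 2) ^+ 2 / 4).
  rewrite /nb_squares natr_sum mulr_natl -sumr_const; apply: ler_sum => -[u v] uv.
  rewrite /= in uv *.
  have := card_vertices uv; have := card_squares_gaps G u v.
  move: #|squares G u v| #|gaps G u v| #|priv G v u| #|priv G u v| => s g a b sg nE.
  have sab : s%:R <= a%:R * b%:R :> R by rewrite -natrM ler_nat -sg leq_addr.
  have abn : a%:R + b%:R <= n - 2.
    by rewrite lerBrDr -!natrD ler_nat nE; lia.
  have a0 : 0 <= a%:R :> R by []. have b0 : 0 <= b%:R :> R by [].
  have := sqr_ge0 (a%:R - b%:R : R).
  nra.
have bal := @balanced_ge R _ n8; rewrite -/n in bal.
have sqn : (nb_squares G)%:R <= n ^+ 2 / 8 * ((n - 2) ^+ 2 / 4).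
  apply: le_trans sqE _; rewrite ler_wpM2r ?divr_ge0 ?sqr_ge0//; exact: ltW.
have Wn : n ^+ 2 * (3 / 32 * (n - 2) ^+ 2 - 1 / 4) <= W by rewrite /W; lra.
have n2 : 0 <= n ^+ 2 by exact: sqr_ge0.
apply: (@le_trans _ _ (n ^+ 2 * (n ^+ 2 / 2))).
  by rewrite mulrC ler_wpM2l.
apply: (@le_trans _ _ (256 * (n ^+ 2 * (3 / 32 * (n - 2) ^+ 2 - 1 / 4)))); last first.
  by rewrite ler_wpM2l.
rewrite [leRHS]mulrCA ler_wpM2l//; nra.
Qed.

(** * The density of K_{3,2} and its maximum *)

Lemma complete_bipartite_blowup (a b : nat) :
  complete_bipartite a b =
  blowup (complete_graph 2) (fun x : 'I_(a + b) => if (x < a)%N then ord0 else ord_max).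
Proof.
apply: val_inj; apply/ffunP => -[x y] /=; rewrite !ffunE /=.
by rewrite adj_mk; do 2!case: ifP.
Qed.

(** K_{3,2} is itself a blow-up of K_2, so the general count applies: 3! 2! = 12, the swapped term
    vanishing since 2^_3 = 0. *)
Lemma card_aut_K32 : #|emb (complete_bipartite 3 2) (complete_bipartite 3 2)| = 12.
Proof.
rewrite [X in emb _ X]complete_bipartite_blowup card_emb_complete_bipartite//.
set X := [set _ | _]; suff XE : #|X| = 3%N.
  by rewrite [#|~: X|]cardsCs finset.setCK XE card_ord.
by rewrite -sum1_card; under eq_bigl do rewrite inE;
  rewrite big_mkcond /= !big_ord_recl big_ord0.
Qed.

(** The equality case of [card_emb_K32]: in a complete bipartite graph every remaining vertex
    extends a 4-cycle to a K_{3,2}. *)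
Lemma ffact_bipartite (x y : nat) :
  (x ^_ 3 * y ^_ 2 + y ^_ 3 * x ^_ 2 = x ^_ 2 * y ^_ 2 * (x + y - 4))%N.
Proof.
rewrite !(ffactnSr _ 2).
have [x2|x2] := ltnP x 2; first by rewrite (ffact_small x2) !mul0n muln0.
have [y2|y2] := ltnP y 2; first by rewrite (ffact_small y2) !mul0n !muln0.
have -> : (x + y - 4 = (x - 2) + (y - 2))%N by lia.
by ring.
Qed.

Section DensityOfK32.
Variable R : realType.
Let gamma : sgraph 'I_5 -> R := gamma_ind R (complete_bipartite 3 2).

(** The factor 10 is 5! divided by the 12 automorphisms. *)
Lemma lambda_K32E (T : finType) (G : sgraph T) :
  lambda gamma G =
  10 * #|emb (complete_bipartite 3 2) G|%:R / (#|T| ^_ 5)%:R.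
Proof.
rewrite /lambda Lambda_gamma_ind card_emb card_aut_K32 -bin_ffact.
have -> : 5`! = 120%N by [].
(* Below order 5 both sides are 0, since division by 0 gives 0. *)
have [->|C0] := eqVneq 'C(#|T|, 5) 0%N; first by rewrite mul0n invr0 !mulr0.
rewrite !natrM; field.
by rewrite pnatr_eq0.
Qed.

Lemma lambda_K32_le (T : finType) (G : sgraph T) : (5 <= #|T|)%N ->
  lambda gamma G <= 5 * (nb_squares G)%:R / (#|T| ^_ 4)%:R.
Proof.
move=> n5; rewrite lambda_K32E (ffactnSr _ 4).
have := card_emb_K32 G; rewrite -(ler_nat R).
rewrite (natrM _ 2) (natrM _ (nb_squares G)) (natrM _ (#|T| ^_ 4)).
have f4 : 0 < (#|T| ^_ 4)%:R :> R by rewrite ltr0n ffact_gt0 ltnW.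
have n4 : 0 < (#|T| - 4)%:R :> R by rewrite ltr0n subn_gt0.
move: (#|T| ^_ 4)%:R (#|T| - 4)%:R f4 n4 => f m f0 m0 H.
rewrite ler_pdivrMr ?mulr_gt0// mulrA divfK ?gt_eqF//.
by lra.
Qed.

Lemma lambda_K32_blowup (T : finType) (c : T -> 'I_2) : (5 <= #|T|)%N ->
  let X := [set x | c x == ord0] in
  lambda gamma (blowup (complete_graph 2) c) =
  10 * (#|X| ^_ 2 * #|~: X| ^_ 2)%:R / (#|T| ^_ 4)%:R.
Proof.
move=> n5 X; rewrite lambda_K32E card_emb_complete_bipartite// -/X.
rewrite ffact_bipartite cardsC (ffactnSr _ 4).
rewrite (natrM _ (#|X| ^_ 2 * _)) (natrM _ (#|T| ^_ 4)); field.
by rewrite !pnatr_eq0 -!lt0n ffact_gt0 subn_gt0 n5 ltnW.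
Qed.

(** The upper bound is [nb_squares_le]; the blow-up with parts n/2 rounded down and up attains
    it. *)
Lemma lambda_max_K32 (n : nat) : (8 <= n)%N ->
  lambda_max no_forbidden gamma n = 10 * (balanced n)%:R / (n ^_ 4)%:R.
Proof.
move=> n8; set b : R := RHS.
have ub (G : sgraph 'I_n) : lambda gamma G <= b.
  have n8' : (8 <= #|'I_n|)%N by rewrite card_ord.
  have n5 : (5 <= #|'I_n|)%N by rewrite (leq_trans _ n8').
  apply: le_trans (lambda_K32_le G n5) _; rewrite card_ord ler_wpM2r ?invr_ge0//.
  by have := nb_squares_le G n8'; rewrite card_ord -(ler_nat R) natrM; lra.
pose c (i : 'I_n) : 'I_2 := if (i < n./2)%N then ord0 else ord_max.
have lc : lambda gamma (blowup (complete_graph 2) c) = b.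
  rewrite lambda_K32_blowup card_ord ?(leq_trans _ n8)//.
  set X := [set _ | _]; have XE : #|X| = n./2.
    rewrite -sum1_card -[RHS]card_ord -[RHS]sum1_card.
    rewrite (big_ord_widen n (fun=> 1%N)); last by lia.
    by apply: eq_bigl => i; rewrite inE /c; case: ifP.
  rewrite [#|~: X|]cardsCs finset.setCK XE card_ord.
  suff -> : (n - n./2 = uphalf n)%N by [].
  by rewrite uphalf_half -{1}(odd_double_half n) -addnn addnA addnK.
rewrite /lambda_max; apply/eqP; rewrite eq_le; apply/andP; split.
  apply: ge_sup; last by move=> _ [G _ <-].
  by exists b; exists (blowup (complete_graph 2) c).
rewrite -lc; apply: ub_le_sup; last by exists (blowup (complete_graph 2) c).
by exists b => _ [G _ <-].
Qed.

End DensityOfK32.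

(** * Perfect stability *)

Lemma perfectly_stable_K32 (R : realType) :
  perfectly_stable no_forbidden (gamma_ind R (complete_bipartite 3 2))
    (complete_graph 2).
Proof.
(* Any C with 5 C >= 2 * 256 survives the final comparison; 103 is the least such integer and also
   ensures order at least 8. *)
exists 103; split=> // T G _; rewrite (ler_nat _ 103) => n103.
have n8 : (8 <= #|T|)%N by rewrite (leq_trans _ n103).
have n5 : (5 <= #|T|)%N by rewrite (leq_trans _ n8).
rewrite lambda_max_K32//; have := lambda_K32_le R G n5.
set lam := lambda _ _ => lamle.
rewrite /edit_dist; set D : set R := [set _ | _ in _]%classic.
have D0 : lbound D 0 by move=> _ [H _ <-].
have Dne : (D !=set0)%classic.
  by exists (nb_changes G (blowup (complete_graph 2) (fun=> ord0)))%:R;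
     exists (blowup (complete_graph 2) (fun=> ord0)) => //; exists (fun=> ord0).
have inf0 : 0 <= inf D by exact: lb_le_inf.
have : inf D * #|T|%:R ^+ 2 <=
    256 * (2 * (balanced #|T|)%:R - (nb_squares G)%:R).
  apply: edit_le_loss => // H HB; apply: ge_inf; first by exists 0.
  by exists H.
have b2 : 'C(#|T|, 2)%:R = (#|T|%:R * (#|T|%:R - 1)) / 2 :> R.
  rewrite -natr_ffact2 -bin_ffact (natrM _ _ 2`!) (_ : 2`! = 2)%N//.
  by rewrite mulfK// pnatr_eq0.
rewrite natr_ffact4 in lamle *; rewrite b2.
have : 103 <= #|T|%:R :> R by rewrite (ler_nat _ 103).
move: (inf D) inf0 lam lamle => d d0 lam.
move: (balanced _)%:R (nb_squares _)%:R #|T|%:R => b q n lamle n103R dW.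
set f := n * (n - 1) * (n - 2) * (n - 3) in lamle *.
have f0 : 0 < f by rewrite /f !mulr_gt0//; lra.
apply: (@le_trans _ _ (103 * (5 * (2 * b - q) / f))); last first.
  by rewrite ler_pM2l//; lra.
have -> : d / (n * (n - 1) / 2) = 2 * d * (n - 2) * (n - 3) / f.
  by rewrite /f; field; rewrite ?gt_eqF//; lra.
rewrite mulrA ler_pM2r ?invr_gt0//.
have : d * ((n - 2) * (n - 3)) <= d * n ^+ 2 by rewrite ler_wpM2l//; nra.
have : 0 <= d * n ^+ 2 by rewrite mulr_ge0// sqr_ge0.
lra.
Qed.

(** * Limit densities and optimal part sizes *)

Local Open Scope classical_set_scope.

Lemma cvg_natrV (R : realType) : (fun n => n%:R^-1 : R) @ \oo --> (0 : R).
Proof. by rewrite -cvg_shiftS; exact: cvg_harmonic. Qed.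

Lemma cvg_ratio (R : realType) (x : nat -> nat) (a K : R) :
  (forall n, `|(x n)%:R - a * n%:R| <= K) ->
  (fun n => (x n)%:R * n%:R^-1) @ \oo --> a.
Proof.
move=> xK; apply/cvgrPdist_lt => /= e e0.
have K0 : 0 <= K by exact: le_trans (normr_ge0 _) (xK 0%N).
near=> n.
have n0 : 0 < n%:R :> R by rewrite ltr0n; near: n; exact: nbhs_infty_gt.
have -> : a - (x n)%:R / n%:R = - ((x n)%:R - a * n%:R) / n%:R.
  by field; rewrite gt_eqF.
rewrite normrM normrN normfV (gtr0_norm n0) ltr_pdivrMr//.
apply: le_lt_trans (xK n) _; rewrite mulrC -ltr_pdivrMr//.
by near: n; exact: nbhs_infty_gtr.
Unshelve. all: by end_near. Qed.

(** Dividing numerator and denominator by n^4 leaves polynomials in x/n, y/n and 1/n; since a + b =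
    1, the denominator tends to 1. *)
Lemma cvg_density (R : realType) (x y : nat -> nat) (a b K : R) : a + b = 1 ->
  (forall n, `|(x n)%:R - a * n%:R| <= K) ->
  (forall n, `|(y n)%:R - b * n%:R| <= K) ->
  (fun n => 10 * (x n ^_ 2 * y n ^_ 2)%:R / ((x n + y n) ^_ 4)%:R) @ \oo -->
  (10 * (a ^+ 2 * b ^+ 2) : R).
Proof.
move=> ab xK yK.
pose i n : R := n%:R^-1.
pose u n : R := (x n)%:R * n%:R^-1; pose v n : R := (y n)%:R * n%:R^-1.
have ci : i @ \oo --> (0 : R) by exact: cvg_natrV.
have cu : u @ \oo --> a by exact: cvg_ratio xK.
have cv : v @ \oo --> b by exact: cvg_ratio yK.
pose w n := u n + v n.
have cw : w @ \oo --> (1 : R) by rewrite -ab; exact: cvgD.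
have cBi f l (k : R) : f @ \oo --> (l : R) -> f n - k * i n @[n --> \oo] --> l.
  move=> cf; rewrite -[l]subr0 -[X in _ - X](mulr0 k).
  by apply: cvgB => //; exact: cvgMl_tmp.
pose num n := 10 * (u n * (u n - 1 * i n) * (v n * (v n - 1 * i n))).
pose den n := w n * (w n - 1 * i n) * (w n - 2 * i n) * (w n - 3 * i n).
have : num n / den n @[n --> \oo] --> 10 * (a * a * (b * b)) / (1 * 1 * 1 * 1).
  apply: cvgM.
    by apply: cvgMl_tmp; apply: cvgM; apply: cvgM => //; exact: cBi.
  apply: cvgV; first by rewrite !mulr1 oner_neq0.
  by do 3?[apply: cvgM; last exact: cBi].
rewrite !mul1r invr1 mulr1 -!expr2; apply: cvg_trans; apply: near_eq_cvg.
near=> n.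
have n0 : n%:R != 0 :> R by rewrite pnatr_eq0 -lt0n; near: n; exact: nbhs_infty_gt.
have -> : num n / den n = n%:R ^+ 4 * num n / (n%:R ^+ 4 * den n).
  by rewrite -[RHS]mulf_div divff ?mul1r// expf_neq0.
rewrite (natrM _ (_ ^_ 2)) !natr_ffact2 natr_ffact4 natrD.
congr (_ / _); rewrite /num /den /w /u /v /i; field.
Unshelve. all: by end_near. Qed.

Lemma card_tag (I : finType) (V : I -> finType) (i : I) :
  #|[set u : {j : I & V j} | tag u == i]%SET| = #|V i|.
Proof.
pose f (x : V i) : {j : I & V j} := Tagged V x.
have fI : injective f by move=> x y; exact: eq_from_Tagged.
rewrite -cardsT -(card_imset _ fI); apply: eq_card => -[j x]; rewrite inE /=.
apply/eqP/imsetP => [ji|[y _ /(congr1 tag)]//].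
by subst j; exists x.
Qed.

Lemma card_blowup_parts (V : 'I_2 -> finType) :
  #|{: {i : 'I_2 & V i}}| = (#|V ord0| + #|V ord_max|)%N.
Proof.
rewrite card_tagged sumnE big_map big_enum /= !big_ord_recl big_ord0 addn0.
by congr (_ + #|V _|)%N; apply: val_inj.
Qed.

Section BlowupLimit.
Variable R : realType.
Let gamma : sgraph 'I_5 -> R := gamma_ind R (complete_bipartite 3 2).

Lemma big_I2 (M : nmodType) (f : 'I_2 -> M) : \sum_i f i = f ord0 + f ord_max.
Proof.
by rewrite !big_ord_recl big_ord0 addr0; congr (_ + f _); apply: val_inj.
Qed.

Lemma blowup_limit_K32 (a : 'rV[R]_2) : simplex a ->
  is_blowup_limit gamma (complete_graph 2) a
    (10 * (a 0 ord0 ^+ 2 * a 0 ord_max ^+ 2)).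
Proof.
move=> [a0 a1] V [K VK]; rewrite big_I2 in a1.
have := cvg_density a1 (VK^~ ord0) (VK^~ ord_max).
apply: cvg_trans; apply: near_eq_cvg; near=> n.
(* The parts have total size at least n - 2K, so the order is eventually at least 5. *)
have n5 : (5 <= #|{: {i : 'I_2 & V n i}}|)%N.
  rewrite card_blowup_parts -(ler_nat R) natrD.
  have : 5 + 2 * K <= n%:R by near: n; exact: nbhs_infty_ger.
  have := VK n ord0; have := VK n ord_max; rewrite !ler_norml.
  have : n%:R = a 0 ord0 * n%:R + a 0 ord_max * n%:R by rewrite -mulrDl a1 mul1r.
  by lra.
rewrite /blowup_parts lambda_K32_blowup// card_blowup_parts.
rewrite [#|(~: _)%SET|](_ : _ = #|V n ord_max|) ?card_tag//.
rewrite -card_tag; apply: eq_card => u; rewrite !inE.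
by case: (tag u) => [[|[|?]] ?].
Unshelve. all: by end_near. Qed.

(** The value chosen by [get] is pinned down by uniqueness of limits along one concrete sequence of
    parts, of sizes a_i n rounded down; with no such sequence every number would qualify. *)
Lemma blowup_lambda_K32 (a : 'rV[R]_2) : simplex a ->
  blowup_lambda gamma (complete_graph 2) a =
  10 * (a 0 ord0 ^+ 2 * a 0 ord_max ^+ 2).
Proof.
move=> sa; pose V (n : nat) (i : 'I_2) : finType := 'I_(Num.truncn (a 0 i * n%:R)).
have VK : exists K : R, forall n i, `| #|V n i|%:R - a 0 i * n%:R | <= K.
  exists 1 => n i; rewrite card_ord.
  have /truncn_itv/andP[] : 0 <= a 0 i * n%:R by case: sa => a0 _; rewrite mulr_ge0.
  by rewrite -natr1 ler_norml; lra.
have lim := blowup_limit_K32 sa.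
have lim' : is_blowup_limit gamma (complete_graph 2) a
    (blowup_lambda gamma (complete_graph 2) a).
  by rewrite /blowup_lambda; apply: getPex; eexists; exact: lim.
apply: cvg_unique (lim' V VK) (lim V VK); exact: norm_hausdorff.
Qed.

Lemma is_maximiser_K32 (a : 'rV[R]_2) :
  is_maximiser gamma (complete_graph 2) a <-> a = const_mx (1 / 2).
Proof.
have shalf : simplex (const_mx (1 / 2) : 'rV[R]_2).
  by split=> [i|]; rewrite ?big_I2 !mxE; lra.
split=> [[sa amax]|->].
- have := amax _ shalf; rewrite !blowup_lambda_K32// !mxE.
  case: sa => a0 a1; rewrite big_I2 in a1; move: (a0 ord0) (a0 ord_max) => x0 y0.
  rewrite -!exprMn => xy.
  (* With x = a_0, optimality gives x(1 - x) >= 1/4, that is, (x - 1/2)^2 <= 0. *)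
  have half : a 0 ord0 = 1 / 2.
    have : (1 / 2 * (1 / 2)) <= a 0 ord0 * a 0 ord_max.
      by rewrite -ler_sqr ?nnegrE ?mulr_ge0//; lra.
    have -> : a 0 ord_max = 1 - a 0 ord0 by lra.
    move=> x14; apply/eqP; rewrite -subr_eq0 -sqrf_eq0 eq_le sqr_ge0 andbT.
    by lra.
  apply/rowP => i; rewrite mxE; case: i => -[|[|//]] ip.
    by rewrite (_ : Ordinal ip = ord0)//; apply: val_inj.
  by rewrite (_ : Ordinal ip = ord_max); [lra | apply: val_inj].
- split=> // b sb; rewrite !blowup_lambda_K32// !mxE -!exprMn.
  case: sb => b0 b1; rewrite big_I2 in b1.
  rewrite ler_pM2l// ler_sqr ?nnegrE ?mulr_ge0//.
  have -> : b 0 ord_max = 1 - b 0 ord0 by lra.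
  by have := sqr_ge0 (b 0 ord0 - 1 / 2); lra.
Qed.

End BlowupLimit.

(** The extremal parts are within 1 of n/2, so [cvg_density] applies with a = b = 1/2. *)
Lemma lambda_max_K32_cvg (R : realType) :
  lambda_max no_forbidden (gamma_ind R (complete_bipartite 3 2)) n
    @[n --> \oo] --> (5 / 8 : R).
Proof.
have half1 : 1 / 2 + 1 / 2 = 1 :> R by lra.
have H (b : bool) (n : nat) :
    `|(if b then uphalf n else n./2)%:R - 1 / 2 * n%:R| <= 1 :> R.
  rewrite uphalf_half (natr_half R n) ler_norml.
  by case: b; rewrite ?natrD; case: (odd n); rewrite /=; lra.
have := cvg_density half1 (H false) (H true).
have -> : 10 * ((1 / 2) ^+ 2 * (1 / 2) ^+ 2) = 5 / 8 :> R by field.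
apply: cvg_trans; apply: near_eq_cvg; near=> n.
rewrite lambda_max_K32; last by near: n; exact: nbhs_infty_ge.
suff -> : (n./2 + uphalf n)%N = n by [].
by rewrite uphalf_half addnCA addnn odd_double_half.
Unshelve. all: by end_near. Qed.

Theorem theorem1p6 (R : realType) :
  let gamma : sgraph 'I_5 -> R := gamma_ind R (complete_bipartite 3 2) in
  let B : sgraph 'I_2 := complete_graph 2 in
  [/\ perfectly_stable no_forbidden gamma B,
      (fun n => lambda_max no_forbidden gamma n) @ \oo --> (5 / 8 : R)
    & forall a : 'rV[R]_2, is_maximiser gamma B a <-> a = const_mx (1 / 2)].
Proof.
split; [exact: perfectly_stable_K32 | exact: lambda_max_K32_cvg |].
exact: is_maximiser_K32.
Qed.
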